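(* Let $\mathbf A=(a_{ij})\in\mathbb H^{n\times n}$ have index $k$, with $\operatorname{rank}\mathbf A^{k+1}=\operatorname{rank}\mathbf A^{k}=r\le n$, and let $\mathbf b=(b_i)\in\mathbb H^{n\times 1}$ be a constant column vector. Consider the particular solution $\mathbf X(t)=(x_i(t))_{i=1}^n$ of the system $\mathbf x'(t)=\mathbf A\mathbf x(t)+\mathbf b$ given by $$\mathbf X(t)=-\mathbf A^{D}\mathbf b+(\mathbf b-\mathbf A^{D}\mathbf A\mathbf b)t+\frac1{2}(\mathbf A\mathbf b-\mathbf A^{D}\mathbf A^{2}\mathbf b)t^{2}+\dots+\frac1{k!}(\mathbf A^{k-1}\mathbf b-\mathbf A^{D}\mathbf A^{k}\mathbf b)t^{k}.$$ Write $\widehat{\mathbf b}^{(l)}=(\widehat b^{(l)}_i):=\mathbf A^{l}\mathbf b$ for $l=0,\dots,2k$ (so $\widehat{\mathbf b}^{(0)}=\mathbf b$). Then for all $i=1,\dots,n$ $$x_i(t)=-C_i^{(0)}+\sum_{m=1}^{k}\frac{1}{m!}\left(\widehat b_i^{(m-1)}-C_i^{(m)}\right)t^{m},$$ where the $C_i^{(m)}$ ($m=0,\dots,k$) are given as follows. (i) When $\mathbf A$ is Hermitian, $$C_i^{(m)}=\frac{\sum_{\beta\in J_{r,n}\{i\}}\operatorname{cdet}_i\left(\left(\mathbf A^{k+1}\right)_{.i}\left(\widehat{\mathbf b}^{(k+m)}\right)\right)_{\beta}^{\beta}}{\sum_{\beta\in J_{r,n}}\left|\left(\mathbf A^{k+1}\right)_{\beta}^{\beta}\right|}.$$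 (ii) When $\mathbf A$ is arbitrary, $$C_i^{(m)}=\frac{\sum_{s=1}^{n}a_{is}^{(k)}\sum_{\beta\in J_{r,n}\{s\}}\operatorname{cdet}_s\left(\left((\mathbf A^{2k+1})^{*}\mathbf A^{2k+1}\right)_{.s}\left(\widehat{\mathbf d}^{(m)}\right)\right)_{\beta}^{\beta}}{\sum_{\beta\in J_{r,n}}\left|\left((\mathbf A^{2k+1})^{*}\mathbf A^{2k+1}\right)_{\beta}^{\beta}\right|},$$ where $\widehat{\mathbf d}^{(l)}:=(\mathbf A^{2k+1})^{*}\mathbf A^{k+l}\mathbf b\in\mathbb H^{n\times 1}$ for $l=0,\dots,k$, and $a_{is}^{(k)}$ is the $(i,s)$ entry of $\mathbf A^k$.
   Context: $\mathbb H$ is the real quaternion skew field; $\mathbf A^{*}$ is the conjugate transpose; $\mathbf A$ is Hermitian if $\mathbf A^*=\mathbf A$. Derivatives of functions $\mathbb R\to\mathbb H$ (and of matrix-valued functions) are taken componentwise. Index and Drazin inverse: $k=\operatorname{Ind}\mathbf A$ is the smallest positive integer with $\operatorname{rank}\mathbf A^{k+1}=\operatorname{rank}\mathbf A^{k}$. The Drazin inverse $\mathbf A^D$ is the unique matrix $\mathbf X$ with $\mathbf X\mathbf A\mathbf X=\mathbf X$, $\mathbf A\mathbf X=\mathbf X\mathbf A$, $\mathbf A^{k+1}\mathbf X=\mathbf A^{k}$. Column determinants: for $\mathbf M=(m_{ij})\in\mathbb H^{n\times n}$ and $j\in\{1,\dots,n\}$, $$\operatorname{cdet}_j\mathbf M=\sum_{\tau\in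 S_n}(-1)^{n-p}\,(m_{j_{k_p}j_{k_p+l_p}}\cdots m_{j_{k_p+1}j_{k_p}})\cdots(m_{j\,j_{k_1+l_1}}\cdots m_{j_{k_1+1}j_{k_1}}m_{j_{k_1}j}),$$ where $\tau$ is written as a product of its $p$ disjoint cycles (fixed points included) $\tau=(j_{k_p+l_p}\dots j_{k_p+1}j_{k_p})\cdots(j_{k_2+l_2}\dots j_{k_2+1}j_{k_2})(j_{k_1+l_1}\dots j_{k_1+1}j_{k_1}j)$ with $j_{k_2}<j_{k_3}<\dots<j_{k_p}$ and $j_{k_t}<j_{k_t+s}$ for $t=2,\dots,p$, $s=1,\dots,l_t$ (the cycle containing $j$ is the rightmost one; a fixed point $c$ contributes the factor $m_{cc}$). For a Hermitian matrix all column determinants (and all row determinants) coincide and are real; their common value is $\det\mathbf M$. $\mathbf M_{.j}(\mathbf c)$ denotes the matrix obtained from $\mathbf M$ by replacing its $j$th column by the column $\mathbf c$. For $\beta=\{\beta_1<\dots<\beta_r\}\subseteq\{1,\dots,n\}$, $\mathbf M_\beta^\beta$ is the principal submatrix with rows and columns indexed by $\beta$; rows and columns of $\mathbf M_\beta^\beta$ keep their original indices, so for $i\in\beta$, $\operatorname{cdet}_i(\mathbf M)_\beta^\beta$ is the column determinant of the submatrix $\mathbf M_\beta^\beta$ along the column with original index $i$. For Hermitian $\mathbf M$, $|\mathbf M_\beta^\beta|$ is the principal minor $\det\mathbf M_\beta^\beta$. $J_{r,n}$ is the set of all $r$-element subsets (strictly increasing sequences) of $\{1,\dots,n\}$, and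 $J_{r,n}\{i\}=\{\beta\in J_{r,n}: i\in\beta\}$. *)

(* Defs.v *)
From HB Require Import structures.
From mathcomp Require Import all_boot all_order all_fingroup all_algebra.
From mathcomp Require Import ring.
From mathcomp Require Import all_classical all_reals all_analysis.

Set Implicit Arguments.
Unset Strict Implicit.
Unset Printing Implicit Defensive.

Import Order.TTheory GRing.Theory Num.Theory.
Local Open Scope ring_scope.

(* The quaternion [Quat a b c d] is a + b i + c j + d k. *)
Record quat (R : Type) : Type := Quat { qre : R; qi : R; qj : R; qk : R }.

Definition quat_to_prod (R : Type) (x : quat R) : R * R * (R * R) :=
  ((qre x, qi x), (qj x, qk x)).
Definition quat_of_prod (R : Type) (p : R * R * (R * R)) : quat R :=
  Quat p.1.1 p.1.2 p.2.1 p.2.2.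
Lemma quat_to_prodK (R : Type) : cancel (@quat_to_prod R) (@quat_of_prod R).
Proof. by case. Qed.

HB.instance Definition _ (R : choiceType) :=
  Choice.copy (quat R) (can_type (@quat_to_prodK R)).

Section QuaternionAlgebra.
Variable R : realFieldType.
Implicit Types x y z : quat R.

Definition addq x y :=
  Quat (qre x + qre y) (qi x + qi y) (qj x + qj y) (qk x + qk y).
Definition oppq x := Quat (- qre x) (- qi x) (- qj x) (- qk x).
Definition mulq x y :=
  Quat (qre x * qre y - qi x * qi y - qj x * qj y - qk x * qk y)
       (qre x * qi y + qi x * qre y + qj x * qk y - qk x * qj y)
       (qre x * qj y - qi x * qk y + qj x * qre y + qk x * qi y)
       (qre x * qk y + qi x * qj y - qj x * qi y + qk x * qre y).
Definition scaleq (a : R) x := Quat (a * qre x) (a * qi x) (a * qj x) (a * qk x).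
Definition conjq x := Quat (qre x) (- qi x) (- qj x) (- qk x).
Definition normsq x := qre x ^+ 2 + qi x ^+ 2 + qj x ^+ 2 + qk x ^+ 2.
Definition invq x := scaleq (normsq x)^-1 (conjq x).

Local Ltac quat_ring :=
  repeat case=> ? ? ? ?; rewrite /addq /oppq /mulq /scaleq /=; congr Quat; ring.

Fact addqA : associative addq. Proof. quat_ring. Qed.
Fact addqC : commutative addq. Proof. quat_ring. Qed.
Fact add0q : left_id (Quat 0 0 0 0) addq. Proof. quat_ring. Qed.
Fact addNq : left_inverse (Quat 0 0 0 0) oppq addq. Proof. quat_ring. Qed.
HB.instance Definition _ :=
  GRing.isZmodule.Build (quat R) addqA addqC add0q addNq.

Fact mulqA : associative mulq. Proof. quat_ring. Qed.
Fact mul1q : left_id (Quat 1 0 0 0) mulq. Proof. quat_ring. Qed.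
Fact mulq1 : right_id (Quat 1 0 0 0) mulq. Proof. quat_ring. Qed.
Fact mulqDl : left_distributive mulq addq. Proof. quat_ring. Qed.
Fact mulqDr : right_distributive mulq addq. Proof. quat_ring. Qed.
Fact oneq_neq0 : Quat 1 0 0 0 != 0 :> quat R.
Proof. by apply/eqP=> -[] /eqP; rewrite oner_eq0. Qed.
HB.instance Definition _ := GRing.Zmodule_isNzRing.Build (quat R)
  mulqA mul1q mulq1 mulqDl mulqDr oneq_neq0.

Fact scaleqA a b x : scaleq a (scaleq b x) = scaleq (a * b) x.
Proof. by move: x; quat_ring. Qed.
Fact scale1q : left_id 1 scaleq. Proof. quat_ring. Qed.
Fact scaleqDr : right_distributive scaleq +%R.
Proof. by move=> a; rewrite /GRing.add /=; quat_ring. Qed.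
Fact scaleqDl x : {morph scaleq^~ x : a b / a + b}.
Proof. by move=> a b; rewrite {2}/GRing.add /=; move: x; quat_ring. Qed.
HB.instance Definition _ := GRing.Zmodule_isLmodule.Build R (quat R)
  scaleqA scale1q scaleqDr scaleqDl.

Fact scaleqAl a x y : a *: (x * y) = (a *: x) * y.
Proof. by rewrite /GRing.mul /GRing.scale /=; move: x y; quat_ring. Qed.
HB.instance Definition _ := GRing.Lmodule_isLalgebra.Build R (quat R) scaleqAl.

Fact scaleqAr a x y : a *: (x * y) = x * (a *: y).
Proof. by rewrite /GRing.mul /GRing.scale /=; move: x y; quat_ring. Qed.
HB.instance Definition _ := GRing.Lalgebra_isAlgebra.Build R (quat R) scaleqAr.

Lemma normsq_eq0 x : (normsq x == 0) = (x == 0).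
Proof.
apply/idP/eqP => [|->]; last by rewrite /normsq !expr0n /= !addr0.
case: x => a b c d; rewrite /normsq /=.
rewrite paddr_eq0 ?sqr_ge0 ?addr_ge0 ?sqr_ge0 //.
rewrite paddr_eq0 ?sqr_ge0 ?addr_ge0 ?sqr_ge0 // paddr_eq0 ?sqr_ge0 //.
by rewrite !sqrf_eq0 => /andP[/andP[/andP[/eqP-> /eqP->] /eqP->] /eqP->].
Qed.

Fact mulVq : {in [pred x | x != 0], left_inverse 1 invq *%R}.
Proof.
move=> x; rewrite inE -normsq_eq0; case: x => a b c d n0.
rewrite /GRing.mul /GRing.one /= /mulq /invq /scaleq /conjq /=.
by move: n0; rewrite /normsq /= => n0; congr Quat; field.
Qed.
Fact mulqV : {in [pred x | x != 0], right_inverse 1 invq *%R}.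
Proof.
move=> x; rewrite inE -normsq_eq0; case: x => a b c d n0.
rewrite /GRing.mul /GRing.one /= /mulq /invq /scaleq /conjq /=.
by move: n0; rewrite /normsq /= => n0; congr Quat; field.
Qed.
Fact unitqP x y : y * x = 1 /\ x * y = 1 -> x != 0.
Proof.
by case=> yx1 _; apply/eqP=> x0; move/eqP: yx1; rewrite x0 mulr0 eq_sym oner_eq0.
Qed.
Fact invq_out : {in [predC [pred x | x != 0]], invq =1 id}.
Proof.
move=> x; rewrite !inE negbK => /eqP ->.
by rewrite /invq /scaleq /conjq /= oppr0 mulr0.
Qed.
HB.instance Definition _ := GRing.NzRing_hasMulInverse.Build (quat R)
  mulVq mulqV unitqP invq_out.

End QuaternionAlgebra.

Section QuaternionMatrices.
Variable R : realFieldType.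
Local Notation H := (quat R).

Definition adjmx m n (A : 'M[H]_(m, n)) : 'M[H]_(n, m) := map_mx (@conjq R) A^T.

Definition is_hermitian n (A : 'M[H]_n) : Prop := adjmx A = A.

(* The columns of A with index in S are right linearly independent:
   A *m x is the combination of the columns of A with right coefficients x. *)
Definition right_free_cols m n (A : 'M[H]_(m, n)) (S : {set 'I_n}) : Prop :=
  forall x : 'cV[H]_n,
    (forall j, j \notin S -> x j 0 = 0) -> A *m x = 0 -> x = 0.

(* The library's \rank needs a commutative field.  Over H the right column rank
   below agrees with the left row rank. *)
Definition qrank m n (A : 'M[H]_(m, n)) : nat :=
  \max_(S : {set 'I_n} | `[< right_free_cols A S >]) #|S|.

Definition is_index n (A : 'M[H]_n) (k : nat) : Prop :=
  [/\ (0 < k)%N, qrank (A ^+ k.+1) = qrank (A ^+ k) &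
      forall l, (0 < l)%N -> qrank (A ^+ l.+1) = qrank (A ^+ l) -> (k <= l)%N].

Definition is_drazin n (A : 'M[H]_n) (k : nat) (X : 'M[H]_n) : Prop :=
  [/\ X *m A *m X = X, A *m X = X *m A & A ^+ k.+1 *m X = A ^+ k].

Definition replace_col n (M : 'M[H]_n) (j : 'I_n) (c : 'cV[H]_n) : 'M[H]_n :=
  \matrix_(p, q) if q == j then c p 0 else M p q.

(* M_{c, s c} M_{s c, s^2 c} ... M_{s^-1 c, c} *)
Definition cycle_prod n (M : 'M[H]_n) (s : 'S_n) (c : 'I_n) : H :=
  \prod_(p < #|porbit s c|) M (iter p s c) (iter p.+1 s c).

(* [cdet beta M j], for j in beta, is cdet_j of the principal submatrix of M on
   beta, with the original indices; [cdet [set: 'I_n] M j] is cdet_j M.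
   Permutations of beta are the s : 'S_n with perm_on beta s, and a cycle
   (j_{l} ... j_1 j_0) is read as s : j_l |-> ... |-> j_1 |-> j_0 |-> j_l.
   From left to right, the cycles avoiding j appear by decreasing least element,
   each one started at its least element; the cycle of j, started at j, is
   last. *)
Definition cdet n (beta : {set 'I_n}) (M : 'M[H]_n) (j : 'I_n) : H :=
  \sum_(s : 'S_n | perm_on beta s)
    (-1) ^+ (#|beta| - #|[set porbit s c | c in beta]|) *
    ((\prod_(c <- rev (enum beta) |
             (c \notin porbit s j) && [forall d in porbit s c, (c <= d)%N])
        cycle_prod M s c) *
     cycle_prod M s j).

(* |M_beta^beta| for Hermitian M: the column determinants along all the indices
   of beta then coincide, so any of them may be picked.  The empty minor is 1. *)
Definition principal_minor n (beta : {set 'I_n}) (M : 'M[H]_n) : H :=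
  if [pick j in beta] is Some j then cdet beta M j else 1.

Definition sum_cdet n (r : nat) (M : 'M[H]_n) (c : 'cV[H]_n) (i : 'I_n) : H :=
  \sum_(beta : {set 'I_n} | (#|beta| == r) && (i \in beta))
    cdet beta (replace_col M i c) i.

Definition sum_minors n (r : nat) (M : 'M[H]_n) : H :=
  \sum_(beta : {set 'I_n} | #|beta| == r) principal_minor beta M.

Definition bhat n (A : 'M[H]_n) (b : 'cV[H]_n) (l : nat) : 'cV[H]_n :=
  A ^+ l *m b.

Definition dhat n (A : 'M[H]_n) (b : 'cV[H]_n) (k l : nat) : 'cV[H]_n :=
  adjmx (A ^+ (2 * k).+1) *m (A ^+ (k + l) *m b).

(* The denominators below are real, hence central: left and right division
   agree. *)
Definition C_herm n (A : 'M[H]_n) (b : 'cV[H]_n) (k r m : nat) (i : 'I_n) : H :=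
  sum_cdet r (A ^+ k.+1) (bhat A b (k + m)) i / sum_minors r (A ^+ k.+1).

Definition C_gen n (A : 'M[H]_n) (b : 'cV[H]_n) (k r m : nat) (i : 'I_n) : H :=
  let G := adjmx (A ^+ (2 * k).+1) *m A ^+ (2 * k).+1 in
  (\sum_(s < n) (A ^+ k) i s * sum_cdet r G (dhat A b k m) s) / sum_minors r G.

Definition particular_solution n (A AD : 'M[H]_n) (b : 'cV[H]_n) (k : nat)
    (t : R) : 'cV[H]_n :=
  - (AD *m b) +
  \sum_(1 <= m < k.+1)
    ((t ^+ m / m`!%:R)%:A : H) *: (A ^+ m.-1 *m b - AD *m A ^+ m *m b).

End QuaternionMatrices.

Definition is_qderive (R : realType) (f : R -> quat R) (t : R) (df : quat R) :
    Prop :=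
  [/\ is_derive t 1 (fun u : R => qre (f u)) (qre df),
      is_derive t 1 (fun u : R => qi (f u)) (qi df),
      is_derive t 1 (fun u : R => qj (f u)) (qj df) &
      is_derive t 1 (fun u : R => qk (f u)) (qk df)].

Definition solves_system (R : realType) n (A : 'M[quat R]_n)
    (b : 'cV[quat R]_n) (x : R -> 'cV[quat R]_n) : Prop :=
  forall (t : R) (i : 'I_n),
    is_qderive (fun u => x u i 0) t ((A *m x t + b) i 0).

(* Main.v *)
Require Import Defs.
From HB Require Import structures.
From mathcomp Require Import all_boot all_order all_fingroup all_algebra.
From mathcomp Require Import all_classical all_reals all_analysis.
From mathcomp Require Import fintype finset ring.

Set Implicit Arguments.
Unset Strict Implicit.
Unset Printing Implicit Defensive.

Import Order.TTheory GRing.Theory Num.Theory.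
Local Open Scope ring_scope.

(** The vectors entering the solution are the columns $A^D A^m b$, and the point is
    to compute their entries by column determinants.

    Everything rests on one statement about a Hermitian matrix $M$ of rank $r$
    with $d_r$ the sum of its principal minors of size $r$: $d_r$ is real and
    nonzero, the column with entries
    $z_i = d_r^{-1} \sum_\beta \mathrm{cdet}_i (M_{.i}(M x))_\beta^\beta$ satisfies
    $M z = M x$, and $z = x$ when $x$ is in the range of $M$ ([cramer_solves],
    [cramer_range]).  A Hermitian $A$ is treated with $M = A^{k+1}$, because
    $A^D A^m b$ lies in the range of $M$ and is sent by it to $A^{k+m} b$.  For a
    general $A$ take $M = B^* B$ with $B = A^{2k+1}$ and $x = (A^D)^{k+1} A^m b$:
    then $M x = \widehat d^{(m)}$, and $M$ and $A^k$ have the same kernel, so that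
    $A^k z = A^k x = A^D A^m b$.

    To prove that statement, the permutations in $\mathrm{cdet}_i$ are grouped by
    the index $q$ that precedes the return to $i$.  Removing $q$ from its cycle
    expresses $\mathrm{cdet}_i$ as a right linear form in column $i$, whose
    coefficients are column determinants of smaller blocks ([cdet_expand_col]).
    They form an adjugate $L$ of the block.  For a Hermitian block, induction on
    the size shows that $L$ is Hermitian and that $L M$ is diagonal, with the real
    numbers $\mathrm{cdet}_i M$ on the diagonal; these commute with $M$, which
    forces them to be equal when the off-diagonal entries are nonzero, and in
    general by varying an entry polynomially ([cdet_indep], [herm_expansionP]).

    Summing the adjugates of all blocks of size $m$ gives matrices $P_m$ that obey
    the Faddeev-LeVerrier recurrence $P_{m+1} = d_m I - P_m M$, with $P_m = 0$ for
    $m > n$, and the real trace of $P_m M$ is $m d_m$ ([minor_adjS],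
    [minor_adj_trace]).  If $s$ is the largest size with $d_s \neq 0$, the
    recurrence gives $P_{s+1} M = 0$, because powers of a Hermitian matrix can be
    cancelled.  Hence $P_s M / d_s$ is a projection onto the range of $M$, of real
    trace $s$; but the real trace of a projection is its rank, so $s = r$
    ([minor_adj_rank]).  The relation $P_r M = d_r I - P_{r+1}$ then yields both
    halves of the statement. *)

(** * Quaternions: conjugation, real elements, polynomial dependence on a parameter *)
Section Conjugation.
Variable R : realFieldType.
Implicit Types (x y z : quat R) (a : R).

Lemma addqE x y : x + y = Defs.addq x y. Proof. by []. Qed.
Lemma mulqE x y : x * y = Defs.mulq x y. Proof. by []. Qed.
Lemma oppqE x : - x = Defs.oppq x. Proof. by []. Qed.
Lemma scaleqE a x : a *: x = Defs.scaleq a x. Proof. by []. Qed.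

Lemma conjqK : involutive (@conjq R).
Proof. by case=> a b c d; rewrite /conjq /= !opprK. Qed.

Fact conjq_is_zmod_morphism : zmod_morphism (@conjq R).
Proof.
case=> a b c d [a' b' c' d']; rewrite !(addqE, oppqE) /conjq /Defs.addq /Defs.oppq /=.
by congr Quat; ring.
Qed.
HB.instance Definition _ :=
  GRing.isZmodMorphism.Build (quat R) (quat R) (@conjq R) conjq_is_zmod_morphism.

Lemma conjqM x y : conjq (x * y) = conjq y * conjq x.
Proof.
by case: x y => a b c d [a' b' c' d']; rewrite !mulqE /conjq /Defs.mulq /=; congr Quat; ring.
Qed.

Fact qre_is_zmod_morphism : zmod_morphism (@qre R).
Proof. by case=> a b c d [a' b' c' d']. Qed.
HB.instance Definition _ :=
  GRing.isZmodMorphism.Build (quat R) R (@qre R) qre_is_zmod_morphism.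

Fact qi_is_zmod_morphism : zmod_morphism (@qi R).
Proof. by case=> a b c d [a' b' c' d']. Qed.
HB.instance Definition _ :=
  GRing.isZmodMorphism.Build (quat R) R (@qi R) qi_is_zmod_morphism.

Fact qj_is_zmod_morphism : zmod_morphism (@qj R).
Proof. by case=> a b c d [a' b' c' d']. Qed.
HB.instance Definition _ :=
  GRing.isZmodMorphism.Build (quat R) R (@qj R) qj_is_zmod_morphism.

Fact qk_is_zmod_morphism : zmod_morphism (@qk R).
Proof. by case=> a b c d [a' b' c' d']. Qed.
HB.instance Definition _ :=
  GRing.isZmodMorphism.Build (quat R) R (@qk R) qk_is_zmod_morphism.

(** The real part is a trace: it makes up for the missing commutativity. *)
Lemma qreMC x y : qre (x * y) = qre (y * x).
Proof. by rewrite !mulqE /Defs.mulq /=; ring. Qed.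

Lemma qreZ a x : qre (a *: x) = a * qre x. Proof. by []. Qed.

Lemma qre_alg a : qre (a%:A : quat R) = a.
Proof. by rewrite qreZ mulr1. Qed.

Lemma conjq_real x : conjq x = x -> x = (qre x)%:A.
Proof.
case: x => a b c d; rewrite /conjq /= => -[Hb Hc Hd].
have opp0 (u : R) : - u = u -> u = 0.
  by move=> Hu; apply/eqP; rewrite -eqNr Hu.
by rewrite scaleqE /Defs.scaleq /= (opp0 _ Hb) (opp0 _ Hc) (opp0 _ Hd) mulr1 mulr0.
Qed.

(** The self-conjugate quaternions are the real ones, so they are central: the
    reason why sums that are stable under conjugation may be moved freely. *)
Lemma real_comm x y : conjq x = x -> x * y = y * x.
Proof. by move/conjq_real->; rewrite mulr_algl mulr_algr. Qed.

Lemma conjq_alg a : conjq (a%:A : quat R) = a%:A.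
Proof. by rewrite scaleqE /Defs.scaleq /conjq /= !mulr0 !oppr0. Qed.

Lemma conjq1 : conjq (1 : quat R) = 1.
Proof. by rewrite /conjq /= oppr0. Qed.

Lemma quat_unit x : (x \is a GRing.unit) = (x != 0).
Proof. by []. Qed.

Lemma qre_conj_mul x : qre (conjq x * x) = normsq x.
Proof. by rewrite mulqE /Defs.mulq /conjq /normsq /=; ring. Qed.

Lemma normsq_ge0 x : 0 <= normsq x.
Proof. by rewrite /normsq !addr_ge0 ?sqr_ge0. Qed.

Definition polyfun (f : R -> R) := exists p : {poly R}, forall t, f t = p.[t].
Definition qpolyfun (f : R -> quat R) :=
  [/\ polyfun (fun t => qre (f t)), polyfun (fun t => qi (f t)),
      polyfun (fun t => qj (f t)) & polyfun (fun t => qk (f t))].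

Lemma polyfunD f g : polyfun f -> polyfun g -> polyfun (fun t => f t + g t).
Proof. by move=> [p Hp] [q Hq]; exists (p + q) => t; rewrite hornerD Hp Hq. Qed.
Lemma polyfunB f g : polyfun f -> polyfun g -> polyfun (fun t => f t - g t).
Proof. by move=> [p Hp] [q Hq]; exists (p - q) => t; rewrite hornerD hornerN Hp Hq. Qed.
Lemma polyfunM f g : polyfun f -> polyfun g -> polyfun (fun t => f t * g t).
Proof. by move=> [p Hp] [q Hq]; exists (p * q) => t; rewrite hornerM Hp Hq. Qed.

Lemma polyfun_cst a : polyfun (fun=> a).
Proof. by exists a%:P => t; rewrite hornerC. Qed.

Lemma qpolyfun_cst x : qpolyfun (fun=> x).
Proof. by split; exact: polyfun_cst. Qed.
Lemma qpolyfunD f g : qpolyfun f -> qpolyfun g -> qpolyfun (fun t => f t + g t).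
Proof. by move=> [? ? ? ?] [? ? ? ?]; split; apply: polyfunD. Qed.
Lemma qpolyfunM f g : qpolyfun f -> qpolyfun g -> qpolyfun (fun t => f t * g t).
Proof.
move=> [? ? ? ?] [? ? ? ?].
by split; repeat (first [apply: polyfunB | apply: polyfunD | apply: polyfunM]).
Qed.

Lemma polyfun_eq0 f t0 : polyfun f -> (forall t, t != t0 -> f t = 0) -> f t0 = 0.
Proof.
move=> [p Hp] f0; rewrite Hp.
suff -> : p = 0 by rewrite horner0.
apply/eqP; apply: contraT => p0.
(* a nonzero p would vanish at the size p many points t0 + 1, t0 + 2, ... *)
pose rs := [seq t0 + k.+1%:R | k <- iota 0 (size p)].
have := @max_poly_roots _ p rs p0; rewrite size_map size_iota ltnn; apply.
  apply/allP=> _ /mapP[k _ ->]; rewrite rootE -Hp f0 //.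
  by rewrite -subr_eq0 addrC addKr pnatr_eq0.
rewrite map_inj_uniq ?iota_uniq // => k l /addrI /eqP.
by rewrite eqr_nat => /eqP[].
Qed.

End Conjugation.

(** * Cycles of a permutation multiplied by a transposition *)
Section Orbits.
Variables (T : finType).
Implicit Types (s : {perm T}) (beta : {set T}).

Lemma porbit_mem_on s beta x y : perm_on beta s -> y \in porbit s x ->
  (y \in beta) = (x \in beta).
Proof.
move=> son /porbitP[i ->]; elim: i => [|i IHi]; first by rewrite perm1.
by rewrite expgSr permM perm_closed.
Qed.

Lemma porbit_fix s x : s x = x -> porbit s x = [set x].
Proof.
move=> sx; apply/setP=> y; rewrite inE; apply/idP/eqP=> [/porbitP[i ->]|->].
  by elim: i => [|i IHi]; rewrite ?perm1 // expgSr permM IHi.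
exact: porbit_id.
Qed.

(** The sign $(-1)^{|\beta|-p}$ of the definition is the signature of the
    permutation, hence changes under multiplication by a transposition. *)
Lemma sign_orbits s beta : perm_on beta s ->
  odd (#|beta| - #|[set porbit s c | c in beta]|) = s.
Proof.
move=> son; rewrite /odd_perm.
have -> : porbits s = [set porbit s c | c in beta] :|: [set porbit s c | c in ~: beta].
  rewrite -imsetU setUCr; apply/setP=> B.
  by apply/imsetP/imsetP=> -[x _ ->]; exists x; rewrite ?inE.
rewrite cardsU; set A := imset _ _; set B := imset _ _.
have -> : A :&: B = set0.
  apply/setP=> C; rewrite !inE; apply/negP=> /andP[/imsetP[x xb ->] /imsetP[y]].
  rewrite inE => yb /eqP; rewrite eq_porbit_mem => /(porbit_mem_on son).
  by rewrite xb (negPf yb).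
rewrite cards0 subn0 [#|B|]card_in_imset; last first.
  move=> x y; rewrite !inE => xb yb.
  rewrite !porbit_fix ?(out_perm son) //; exact: set1_inj.
rewrite oddB ?leq_imset_card // -(cardsC beta) !oddD.
by rewrite [RHS]addbACA addbb addbF.
Qed.

Lemma card_porbit_first s x m : (0 < m)%N -> iter m s x = x ->
  (forall p, (0 < p < m)%N -> iter p s x != x) -> #|porbit s x| = m.
Proof.
move=> m0 mx mP; set N := #|porbit s x|.
have N0 : (0 < N)%N by rewrite lt0n card_porbit_neq0.
case: (ltngtP N m) => // [Nm|mN].
  by have := mP N; rewrite N0 Nm iter_porbit eqxx => /(_ isT).
have /(nth_uniq x) := uniq_traject_porbit s x.
rewrite -/N => /(_ 0%N m); rewrite size_traject => /(_ N0 mN).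
by rewrite !nth_traject // mx eqxx; case: m m0 {mx mP mN}.
Qed.

Lemma iter_porbit_neq s x p : (0 < p < #|porbit s x|)%N -> iter p s x != x.
Proof.
move=> /andP[p0 pN].
have /(nth_uniq x) := uniq_traject_porbit s x.
move=> /(_ p 0%N); rewrite size_traject => /(_ pN (leq_ltn_trans (leq0n _) pN)).
rewrite !nth_traject ?(leq_ltn_trans (leq0n _) pN) //= => ->.
by rewrite -lt0n.
Qed.

Lemma mem_iter_porbit s x p : iter p s x \in porbit s x.
Proof.
elim: p => [|p IHp]; first exact: porbit_id.
by move: IHp => /porbitP[i e]; rewrite iterS e -permM -expgSr mem_porbit.
Qed.

Lemma porbit_iterP s x y : y \in porbit s x -> exists2 p, (p < #|porbit s x|)%N & y = iter p s x.
Proof.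
by rewrite porbit_traject => /trajectP[p pN ->]; exists p.
Qed.

(** In this section [q] is a fixed point of [s] outside the cycle of [i].
    Multiplying [s] by the transposition of [i] and [q] inserts [q] into that
    cycle, just before the return to [i], and leaves the other cycles alone. *)
Section Peel.
Variables (s : {perm T}) (i q : T).
Hypotheses (neq_qi : q != i) (sq : s q = q).
Let s' : {perm T} := (s * tperm i q)%g.
Let l := #|porbit s i|.

Lemma peel_iter p : (p < l)%N -> iter p s' i = iter p s i.
Proof.
elim: p => [|p IHp] //= ltpl; rewrite IHp 1?ltnW // permM tpermD //.
- by rewrite -iterS eq_sym; apply: iter_porbit_neq.
- rewrite eq_sym -[X in _ != X]sq (inj_eq perm_inj).
  apply: contraTneq (mem_iter_porbit s i p) => ->.
  by rewrite porbit_sym porbit_fix // inE eq_sym.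
Qed.

Lemma peel_iter_last : iter l s' i = q.
Proof.
have l0 : (0 < l)%N by rewrite lt0n card_porbit_neq0.
rewrite -(prednK l0) iterS peel_iter ?prednK // permM -iterS prednK //.
by rewrite iter_porbit tpermL.
Qed.

Lemma peel_card : #|porbit s' i| = l.+1.
Proof.
apply: card_porbit_first => // [|p /andP[p0]].
  by rewrite iterS peel_iter_last permM sq tpermR.
rewrite ltnS leq_eqVlt => /orP[/eqP->|ltpl]; first by rewrite peel_iter_last.
by rewrite peel_iter // iter_porbit_neq ?p0.
Qed.

Lemma peel_porbit : porbit s' i = q |: porbit s i.
Proof.
apply/setP=> x; rewrite !inE; apply/idP/orP.
  case/porbit_iterP=> p; rewrite peel_card ltnS leq_eqVlt.
  case/orP=> [/eqP->|ltpl] ->; first by left; rewrite peel_iter_last.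
  by right; rewrite peel_iter // mem_iter_porbit.
case=> [/eqP->|/porbit_iterP[p ltpl ->]].
  by rewrite -peel_iter_last mem_iter_porbit.
by rewrite -peel_iter // mem_iter_porbit.
Qed.

Lemma peel_iter_other c p : c \notin porbit s' i -> iter p s' c = iter p s c.
Proof.
move=> cN; elim: p => //= p ->.
have icN x : x \in porbit s c -> x \notin porbit s i.
  rewrite porbit_sym => cx; apply: contraNN cN => xi.
  rewrite peel_porbit inE -eq_porbit_mem; apply/orP; right.
  by move: cx xi; rewrite -!eq_porbit_mem => /eqP-> .
have pc : iter p.+1 s c \in porbit s c by apply: mem_iter_porbit.
rewrite permM -iterS tpermD //.
  by apply: contraNneq (icN _ pc) => <-; apply: porbit_id.
move: cN; apply: contraNneq => e; move: pc; rewrite -e porbit_sym porbit_fix //.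
by rewrite inE => /eqP->; rewrite peel_porbit setU11.
Qed.

Lemma peel_porbit_other c : c \notin porbit s' i -> porbit s' c = porbit s c.
Proof.
move=> cN; have e : #|porbit s' c| = #|porbit s c|.
  apply: card_porbit_first; rewrite ?lt0n ?card_porbit_neq0 //.
    by rewrite peel_iter_other // iter_porbit.
  by move=> p pl; rewrite peel_iter_other // iter_porbit_neq.
apply/setP=> x; apply/idP/idP; case/porbit_iterP=> p _ ->.
  by rewrite peel_iter_other // mem_iter_porbit.
by rewrite -peel_iter_other // mem_iter_porbit.
Qed.

End Peel.
End Orbits.

(** * Expansion of a column determinant along its column *)
Section ColumnExpansion.
Variables (R : realFieldType) (n : nat).
Local Notation H := (quat R).
Implicit Types (M : 'M[H]_n) (beta : {set 'I_n}) (s : 'S_n) (i j a c : 'I_n).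

(** The signed sum over the permutations of [beta] of the products of all their
    cycles, each one started at its least element and placed by decreasing least
    element.  No index is distinguished, and for a Hermitian matrix this is the
    determinant; over any matrix it is the factor left over when the index along
    which one expands is a fixed point. *)
Definition ordered_det beta M : H :=
  \sum_(s : 'S_n | perm_on beta s) (-1) ^+ s *
     \prod_(c <- rev (enum beta) | [forall d in porbit s c, (c <= d)%N])
        cycle_prod M s c.

(** The entry (i, a) of the analogue of the adjugate of the block on [beta]: by
    [cdet_expand_col] it is the left coefficient of the entry at row [a] of
    column [i]. *)
Definition expansion_coef beta M i a : H :=
  if a == i then ordered_det (beta :\ i) M
  else - cdet (beta :\ a) (replace_col M i (col a M)) i.

Lemma perm_onD1 beta a s :
  perm_on (beta :\ a) s = perm_on beta s && (s a == a).
Proof.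
apply/idP/andP=> [son|[son /eqP sa]].
  split; last by rewrite (out_perm son) // !inE eqxx.
  by apply/subsetP=> x /(subsetP son); rewrite !inE => /andP[].
apply/subsetP=> x sx; rewrite !inE (subsetP son x sx) andbT.
by apply: contraNneq sx => ->; rewrite sa.
Qed.

Lemma rev_enum_prod beta (P : pred 'I_n) (F : 'I_n -> H) :
  \prod_(c <- rev (enum beta) | P c) F c =
  \prod_(c <- rev (enum 'I_n) | (c \in beta) && P c) F c.
Proof.
have -> : enum beta = [seq c <- enum 'I_n | c \in beta] by rewrite enumT.
by rewrite -filter_rev big_filter_cond.
Qed.

Lemma cdetE beta M j : cdet beta M j =
  \sum_(s : 'S_n | perm_on beta s) (-1) ^+ s *
    (\prod_(c <- rev (enum beta) |
        (c \notin porbit s j) && [forall d in porbit s c, (c <= d)%N])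
        cycle_prod M s c * cycle_prod M s j).
Proof.
by apply: eq_bigr => s son; rewrite -signr_odd sign_orbits.
Qed.

Lemma eq_cycle_prod M M' s s' c :
  (forall p, iter p s c = iter p s' c) ->
  (forall x y, x \in porbit s c -> y \in porbit s c -> M x y = M' x y) ->
  cycle_prod M s c = cycle_prod M' s' c.
Proof.
move=> ss' MM'; rewrite /cycle_prod.
have -> : #|porbit s' c| = #|porbit s c|.
  apply: card_porbit_first; rewrite ?lt0n ?card_porbit_neq0 //.
    by rewrite -ss' iter_porbit.
  by move=> p pl; rewrite -ss' iter_porbit_neq.
by apply: eq_bigr => p _; rewrite -!ss' MM' // mem_iter_porbit.
Qed.

Lemma replace_colE M j (c : 'cV[H]_n) x y :
  replace_col M j c x y = if y == j then c x 0 else M x y.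
Proof. by rewrite mxE. Qed.

Lemma replace_col_id M j : replace_col M j (col j M) = M.
Proof. by apply/matrixP=> x y; rewrite replace_colE mxE; case: eqP => // ->. Qed.

Lemma cycle_prod_fix M s c : s c = c -> cycle_prod M s c = M c c.
Proof.
by move=> sc; rewrite /cycle_prod porbit_fix // cards1 big_ord1 /= sc.
Qed.

(** The permutations fixing [i] contribute the entry of [c] at [i], with the
    permutations of the remaining indices as coefficient. *)
Lemma cdet_fix_part beta M i (c : 'cV[H]_n) : i \in beta ->
  \sum_(s : 'S_n | perm_on beta s && ((s^-1)%g i == i)) (-1) ^+ s *
    (\prod_(d <- rev (enum beta) |
        (d \notin porbit s i) && [forall e in porbit s d, (d <= e)%N])
        cycle_prod (replace_col M i c) s d * cycle_prod (replace_col M i c) s i)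
  = ordered_det (beta :\ i) M * c i 0.
Proof.
move=> ib; rewrite /ordered_det big_distrl /=; apply: eq_big => s.
  by rewrite perm_onD1 -(inj_eq (@perm_inj _ s) _ i) permKV eq_sym.
case/andP=> son /eqP si; have {}si : s i = i by rewrite -{1}si permKV.
rewrite -mulrA; congr (_ * (_ * _)); last first.
  by rewrite cycle_prod_fix // replace_colE eqxx.
rewrite !rev_enum_prod; apply: eq_big => [d|d /and3P[_ di _]].
  by rewrite porbit_fix // !inE andbCA andbA.
apply: eq_cycle_prod => // x y _ yd; rewrite replace_colE ifN //.
by apply: contraNneq di => <-; rewrite porbit_sym.
Qed.

(** The entry of column [i] is the last factor of the cycle of [i].  When [q] is
    the last element of this cycle, dropping it lets the product end with the
    entry of column [q] of [M] in place of that of column [i]. *)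
Lemma cycle_prod_peel M i q s (c : 'cV[H]_n) : q != i -> s q = q ->
  cycle_prod (replace_col M i c) (s * tperm i q)%g i =
  cycle_prod (replace_col M i (col q M)) s i * c q 0.
Proof.
move=> qi sq; rewrite /cycle_prod peel_card // big_ord_recr /=.
rewrite permM (peel_iter_last qi sq) // sq tpermR replace_colE eqxx.
congr (_ * _); apply: eq_bigr => p _; rewrite -!iterS (peel_iter qi sq) //.
have [ltpl|] := ltnP p.+1 #|porbit s i|.
  have nei : iter p.+1 s i != i by apply: iter_porbit_neq.
  by rewrite (peel_iter qi sq) // !replace_colE (negPf nei).
move=> lepl; have -> : p.+1 = #|porbit s i| by apply/eqP; rewrite eqn_leq lepl ltn_ord.
by rewrite (peel_iter_last qi sq) iter_porbit !replace_colE eqxx (negPf qi) mxE.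
Qed.

(** The permutations sending [q] to [i] are, by insertion of [q], those of
    [beta] without [q]; the transposition is responsible for the sign. *)
Lemma cdet_peel_part beta M i q (c : 'cV[H]_n) :
  i \in beta -> q \in beta -> q != i ->
  \sum_(s : 'S_n | perm_on beta s && ((s^-1)%g i == q)) (-1) ^+ s *
    (\prod_(d <- rev (enum beta) |
        (d \notin porbit s i) && [forall e in porbit s d, (d <= e)%N])
        cycle_prod (replace_col M i c) s d * cycle_prod (replace_col M i c) s i)
  = - cdet (beta :\ q) (replace_col M i (col q M)) i * c q 0.
Proof.
move=> ib qb qi; rewrite cdetE mulNr big_distrl -sumrN /=.
have ont : perm_on beta (tperm i q).
  apply: subset_trans (tperm_on i q) _.
  by apply/subsetP=> x; rewrite !inE => /orP[] /eqP->.
rewrite (reindex_inj (@mulIg _ (tperm i q))) /=; apply: eq_big => s.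
  rewrite perm_onD1; congr andb.
    apply/idP/idP => [st|st]; last exact: perm_onM.
    by rewrite -[s](mulgK (tperm i q)) tpermV; apply: perm_onM.
  rewrite invMg permM tpermV tpermL -(inj_eq (@perm_inj _ s)) permKV eq_sym //.
case/andP=> son /eqP sq'; have sq : s q = q.
  by move: sq'; rewrite invMg permM tpermV tpermL => sVq; rewrite -{1}sVq permKV.
rewrite odd_permM odd_tperm eq_sym qi addbT signrN mulNr -!mulrA; congr (- (_ * _)).
rewrite cycle_prod_peel //; congr (_ * _).
rewrite !rev_enum_prod; have other d : d \notin porbit (s * tperm i q)%g i ->
    porbit (s * tperm i q)%g d = porbit s d by apply: peel_porbit_other.
apply: eq_big => [d|d /and3P[_ di _]].
  rewrite !inE; have [/eqP->|dq] := boolP (d == q).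
    by rewrite peel_porbit // setU11 andbF.
  case: (boolP (d \in porbit _ i)) => di /=.
    by move: di; rewrite peel_porbit // !inE (negPf dq) /= => ->; rewrite !andbF.
  have -> : d \notin porbit s i.
    by apply: contraNN di; rewrite peel_porbit // inE orbC => ->.
  by rewrite other.
apply: eq_cycle_prod => [p|x y _ yd]; first exact: peel_iter_other.
have nyi : y != i.
  by apply: contraNneq di => yi; rewrite porbit_sym -[X in X \in _]yi.
by rewrite !replace_colE (negPf nyi).
Qed.

(** Group the permutations according to the preimage of [i], whose entry in
    column [i] is the last factor of the product.  In particular the column
    determinant along [i] is right linear in column [i]. *)
Lemma cdet_expand_col beta M i (c : 'cV[H]_n) : i \in beta ->
  cdet beta (replace_col M i c) i =
  \sum_(a in beta) expansion_coef beta M i a * c a 0.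
Proof.
move=> ib; rewrite cdetE (partition_big (fun s => (s^-1)%g i) (mem beta)) /=.
  apply: eq_bigr => a ab; rewrite /expansion_coef; case: eqVneq => [->|ai].
    exact: cdet_fix_part.
  exact: cdet_peel_part.
by move=> s son; rewrite perm_closed ?perm_onV.
Qed.

Lemma ordered_det0 M : ordered_det set0 M = 1.
Proof.
rewrite /ordered_det (big_pred1 1%g) => [|s /=].
  by rewrite odd_perm1 mul1r rev_enum_prod big_pred0 // => c; rewrite inE.
apply/idP/eqP=> [s0|->]; last exact: perm_on1.
by apply/permP=> x; rewrite perm1 (out_perm s0) ?inE.
Qed.

(** The cycle of the least index comes last anyway, so distinguishing this index
    changes nothing. *)
Lemma ordered_det_min beta M : beta != set0 ->
  exists2 i, i \in beta & ordered_det beta M = cdet beta M i.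
Proof.
move=> b0; case E : (enum beta) => [|i t].
  by case/set0Pn: b0 => x; rewrite -mem_enum E.
have ib : i \in beta by rewrite -mem_enum E mem_head.
exists i => //; rewrite cdetE; apply: eq_bigr => s son; congr (_ * _).
have le_i d : d \in beta -> (i <= d)%N.
  have : sorted ltn [seq val x | x <- enum beta].
    have -> : enum beta = [seq c <- enum 'I_n | c \in beta] by rewrite enumT.
    rewrite sorted_map; apply: sorted_filter => [x y z /=|]; first exact: ltn_trans.
    by rewrite -sorted_map val_enum_ord iota_ltn_sorted.
  rewrite E /= => /(order_path_min ltn_trans) /allP le_t db.
  move: db; rewrite -mem_enum E inE => /orP[/eqP->//|dt].
  by rewrite ltnW // le_t // map_f.
have it : i \notin t by have := enum_uniq beta; rewrite E => /andP[].
rewrite E rev_cons !big_rcons /= porbit_id /= mulr1.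
have -> : [forall d in porbit s i, (i <= d)%N].
  by apply/forall_inP=> d di; rewrite le_i // (porbit_mem_on son di).
congr (_ * _); rewrite big_seq_cond [RHS]big_seq_cond; apply: eq_bigl => c.
rewrite mem_rev; case ct : (c \in t) => //=.
case: forall_inP => [c_min|]; rewrite ?andbF // andbT.
have cb : c \in beta by rewrite -mem_enum E inE ct orbT.
symmetry; apply: contraNN it => ci.
suff <- : c = i by [].
by apply/ord_inj/eqP; rewrite eqn_leq le_i // c_min // porbit_sym.
Qed.

End ColumnExpansion.

(** * The adjugate of a Hermitian matrix *)
Section PolynomialDependence.
Variable R : realFieldType.
Implicit Types (f g : R -> quat R).

Lemma qpolyfun_ext f g : f =1 g -> qpolyfun f -> qpolyfun g.
Proof.
move=> fg [[p Hp] [q Hq] [r Hr] [s Hs]].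
by split; [exists p | exists q | exists r | exists s] => t; rewrite -fg.
Qed.

Lemma qpolyfun_big (op : quat R -> quat R -> quat R) idx I (r : seq I) (P : pred I)
    (F : I -> R -> quat R) :
  (forall f g, qpolyfun f -> qpolyfun g -> qpolyfun (fun t => op (f t) (g t))) ->
  (forall i, P i -> qpolyfun (F i)) -> qpolyfun (fun t => \big[op/idx]_(i <- r | P i) F i t).
Proof.
move=> Hop HF; elim: r => [|i r IHr].
  by apply: (@qpolyfun_ext (fun=> idx)) => [t|]; [rewrite big_nil | exact: qpolyfun_cst].
case Pi : (P i).
  apply: (@qpolyfun_ext (fun t => op (F i t) (\big[op/idx]_(j <- r | P j) F j t))).
    by move=> t; rewrite big_cons Pi.
  exact: Hop (HF i Pi) IHr.
by apply: qpolyfun_ext IHr => t; rewrite big_cons Pi.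
Qed.

Lemma qpolyfun_cdet n (beta : {set 'I_n}) (M : R -> 'M[quat R]_n) i :
  (forall x y, qpolyfun (fun t => M t x y)) -> qpolyfun (fun t => cdet beta (M t) i).
Proof.
move=> HM.
have Hcyc s c : qpolyfun (fun t => cycle_prod (M t) s c).
  apply: qpolyfun_big => [|p _]; [exact: qpolyfunM | exact: HM].
apply: qpolyfun_big => [|s _]; first exact: qpolyfunD.
apply: qpolyfunM; first exact: qpolyfun_cst.
by apply: qpolyfunM => //; apply: qpolyfun_big => [|c _ //]; exact: qpolyfunM.
Qed.

End PolynomialDependence.

Section HermitianExpansion.
Variables (R : realFieldType) (n : nat).
Local Notation H := (quat R).
Implicit Types (M : 'M[H]_n) (beta gamma : {set 'I_n}) (i j a b q : 'I_n).

Local Notation T := ordered_det.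
Local Notation L := expansion_coef.

(** What is proved by induction on [beta] for all Hermitian matrices at once: the
    determinant is real, the adjugate can also be expanded from the left, it is
    Hermitian, and it is a left inverse of the block on [beta] up to the
    determinant. *)
Definition herm_expansion beta M :=
  [/\ conjq (T beta M) = T beta M,
      {in beta &, forall i a, i != a ->
         L beta M i a = - \sum_(b in beta :\ i) M i b * L (beta :\ i) M b a},
      {in beta &, forall i a, conjq (L beta M i a) = L beta M a i} &
      {in beta &, forall i q,
         \sum_(a in beta) L beta M i a * M a q = if i == q then T beta M else 0}].

Lemma expansion_coef_diag beta M i : L beta M i i = T (beta :\ i) M.
Proof. by rewrite /expansion_coef eqxx. Qed.

Lemma expansion_coef_right beta M i a : i \in beta -> i != a ->
  L beta M i a = - \sum_(b in beta :\ a) L (beta :\ a) M i b * M b a.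
Proof.
move=> ib ia; rewrite {1}/expansion_coef eq_sym (negPf ia).
rewrite cdet_expand_col ?inE ?ia //; congr (- _).
by apply: eq_bigr => b _; rewrite mxE.
Qed.

Lemma cdet_coef beta M i : i \in beta ->
  cdet beta M i = \sum_(a in beta) L beta M i a * M a i.
Proof.
move=> ib; rewrite -[in LHS](replace_col_id M i) cdet_expand_col //.
by apply: eq_bigr => a _; rewrite mxE.
Qed.

Lemma setD1C beta i a : beta :\ i :\ a = beta :\ a :\ i.
Proof. by rewrite !setDDl setUC. Qed.

Lemma hermE M i j : is_hermitian M -> conjq (M i j) = M j i.
Proof. by move=> /matrixP/(_ j i); rewrite !mxE. Qed.

(** The inductive step.  For the block on [beta] the determinant along [i] is not
    yet known to be independent of [i], so [cdet beta M i] stands on the diagonal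
    of the product of the adjugate and the block. *)
Section Induction.
Variables (beta : {set 'I_n}).
Hypothesis IH : forall gamma M, is_hermitian M -> gamma \proper beta ->
  herm_expansion gamma M.
Variable M : 'M[H]_n.
Hypothesis hM : is_hermitian M.

Let properD1_1 i : i \in beta -> beta :\ i \proper beta. Proof. exact: properD1. Qed.
Let properD1_2 i a : i \in beta -> beta :\ i :\ a \proper beta.
Proof. by move=> ib; apply: sub_proper_trans (properD1_1 ib); apply: subD1set. Qed.

(** Expanding [L beta M i a] from the right and then each coefficient from the
    left, or conversely, gives the same double sum, except for one term in which
    the determinant of the block without [i] and [a] stands on either side of
    [M i a]; that determinant is real. *)
Lemma expansion_coef_left i a : i \in beta -> a \in beta -> i != a ->
  L beta M i a = - \sum_(b in beta :\ i) M i b * L (beta :\ i) M b a.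
Proof.
move=> ib ab ia; rewrite expansion_coef_right //; congr (- _).
have ia' : i \in beta :\ a by rewrite !inE ia.
have ai' : a \in beta :\ i by rewrite !inE eq_sym ia.
rewrite (big_setD1 i) //= expansion_coef_diag [RHS](big_setD1 a) //= expansion_coef_diag.
rewrite [beta :\ i :\ a]setD1C; have [Treal _ _ _] := IH hM (properD1_2 i ab).
rewrite real_comm //; congr (_ + _).
have [_ left_a _ _] := IH hM (properD1_1 ab).
transitivity (- \sum_(b in beta :\ a :\ i) \sum_(c in beta :\ a :\ i)
    M i c * L (beta :\ a :\ i) M c b * M b a).
  rewrite -sumrN; apply: eq_bigr => b; rewrite !inE => /and3P[bi ba bb].
  by rewrite left_a ?inE ?ba ?ia // 1?eq_sym // mulNr big_distrl.
rewrite exchange_big -sumrN /=; apply: eq_bigr => c; rewrite !inE => /and3P[ci ca cb].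
rewrite expansion_coef_right ?inE ?ci // [beta :\ i :\ a]setD1C mulrN big_distrr /=; congr (- _).
by apply: eq_bigr => b _; rewrite mulrA.
Qed.

(** Conjugation exchanges the right and the left expansion. *)
Lemma expansion_coef_conj i a : i \in beta -> a \in beta -> conjq (L beta M i a) = L beta M a i.
Proof.
move=> ib ab; case: (eqVneq i a) => [->|ia].
  by rewrite expansion_coef_diag; have [] := IH hM (properD1_1 ab).
have [_ _ conj_a _] := IH hM (properD1_1 ab).
rewrite expansion_coef_right // expansion_coef_left 1?eq_sym // raddfN raddf_sum /=; congr (- _).
apply: eq_bigr => b bb; rewrite conjqM hermE // conj_a // !inE ia //.
Qed.

Lemma row_expand i q : i \in beta ->
  \sum_(a in beta) L beta M i a * M a q = T (beta :\ i) M * M i q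
   - \sum_(a in beta :\ i) \sum_(b in beta :\ i) M i b * L (beta :\ i) M b a * M a q.
Proof.
move=> ib; rewrite (big_setD1 i) //= expansion_coef_diag -sumrN; congr (_ + _).
apply: eq_bigr => a; rewrite !inE => /andP[ai ab].
by rewrite expansion_coef_left 1?eq_sym // mulNr big_distrl.
Qed.

(** A left expansion turns the terms with [a] other than [i] into the opposite of
    row [i] of [M] times the product of adjugate and block for [beta] without
    [i].  This product is scalar, so they cancel the term with [a = i]. *)
Lemma row_offdiag i q : i \in beta -> q \in beta -> i != q ->
  \sum_(a in beta) L beta M i a * M a q = 0.
Proof.
move=> ib qb iq; rewrite row_expand // exchange_big /=.
have qi : q \in beta :\ i by rewrite !inE eq_sym iq.
have [Treal _ _ LM] := IH hM (properD1_1 ib).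
rewrite (big_setD1 q) //= [X in _ - (_ + X)]big1 => [|b]; last first.
  rewrite in_setD1 => /andP[bq bi].
  under eq_bigr do rewrite -mulrA.
  by rewrite -big_distrr /= LM // (negPf bq) mulr0.
under eq_bigr do rewrite -mulrA.
by rewrite -big_distrr /= LM // eqxx addr0 real_comm // subrr.
Qed.

(** The bordered expansion of the determinant along [i] is stable under
    conjugation, which exchanges its two summation indices. *)
Lemma cdet_real i : i \in beta -> conjq (cdet beta M i) = cdet beta M i.
Proof.
move=> ib; rewrite cdet_coef // row_expand // raddfB /= conjqM hermE //.
have [Treal _ conj_i _] := IH hM (properD1_1 ib).
rewrite Treal -real_comm //; congr (_ - _).
rewrite raddf_sum exchange_big /=; apply: eq_bigr => a ai.
rewrite raddf_sum; apply: eq_bigr => b bi /=.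
by rewrite !conjqM !hermE // conj_i // mulrA.
Qed.

(** With [D] the diagonal matrix of the determinants along the indices, the
    adjugate [L] satisfies [L M = D]; taking conjugate transposes, [M L = D].
    Hence [D M = M L M = M D], entrywise. *)
Lemma cdet_intertwine i j : i \in beta -> j \in beta ->
  cdet beta M i * M i j = M i j * cdet beta M j.
Proof.
move=> ib jb.
have LM a q : a \in beta -> q \in beta ->
    \sum_(b in beta) L beta M a b * M b q = if a == q then cdet beta M a else 0.
  move=> ab qb; case: eqVneq => [->|aq]; last exact: row_offdiag.
  by rewrite cdet_coef.
have ML a q : a \in beta -> q \in beta ->
    \sum_(b in beta) M a b * L beta M b q = if a == q then cdet beta M a else 0.
  move=> ab qb; rewrite -[LHS]conjqK raddf_sum /=.
  under eq_bigr => b bb do rewrite conjqM hermE // expansion_coef_conj //.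
  rewrite LM // eq_sym; case: eqVneq => [->|_]; last exact: raddf0.
  exact: cdet_real.
transitivity (\sum_(a in beta) \sum_(b in beta) M i a * L beta M a b * M b j).
  rewrite exchange_big (bigD1 i) //= [X in _ = _ + X]big1 => [|b /andP[bb bi]].
    by rewrite -big_distrl /= ML // eqxx addr0.
  by rewrite -big_distrl /= ML // eq_sym (negPf bi) mul0r.
rewrite (bigD1 j) //= [X in _ + X = _]big1 => [|a /andP[ab aj]].
  under eq_bigr do rewrite -mulrA.
  by rewrite -big_distrr /= LM // eqxx addr0.
under eq_bigr do rewrite -mulrA.
by rewrite -big_distrr /= LM // (negPf aj) mulr0.
Qed.

End Induction.

(** When [M i j] is nonzero, [cdet_intertwine] gives the equality.  When it is
    zero, add a real parameter [t] to the entries (i, j) and (j, i): the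
    difference of the two determinants is a polynomial in [t], zero for all
    nonzero [t], hence also at [t = 0]. *)
Lemma cdet_indep beta : (forall gamma M, is_hermitian M -> gamma \proper beta ->
  herm_expansion gamma M) ->
  forall M, is_hermitian M -> {in beta &, forall i j, cdet beta M i = cdet beta M j}.
Proof.
move=> IH M hM i j ib jb; case: (eqVneq i j) => [->//|ij].
have cancel_M (N : 'M[H]_n) : is_hermitian N -> N i j != 0 ->
    cdet beta N i = cdet beta N j.
  move=> hN Nij; apply: (mulIr (x := N i j)) => //.
  by rewrite (cdet_intertwine IH hN ib jb) [RHS]real_comm ?(cdet_real IH hN jb).
have [Mij|] := eqVneq (M i j) 0; last exact: cancel_M.
pose E : 'M[H]_n := delta_mx i j + delta_mx j i.
have hE : is_hermitian E.
  apply/matrixP=> x y; rewrite !mxE raddfD /= addrC.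
  by congr (_ + _); rewrite andbC; case: andb; rewrite /= ?raddf0 ?conjq1.
have hN (t : R) : is_hermitian (M + t%:A *: E).
  apply/matrixP=> x y; rewrite ![adjmx _ _ _]mxE [_^T _ _]mxE.
  move: E hE => F hF; rewrite !mxE raddfD /= conjqM conjq_alg !hermE //.
  by rewrite mulr_algl mulr_algr.
pose N (t : R) := M + t%:A *: E.
have N0 : N 0 = M by rewrite /N !scale0r addr0.
have Nij t : N t i j = t%:A.
  by rewrite !mxE Mij !eqxx (negPf ij) /= addr0 add0r mulr1.
have polyN k : qpolyfun (fun t => cdet beta (N t) k).
  apply: qpolyfun_cdet => x y.
  apply: (@qpolyfun_ext _ (fun t => M x y + t%:A * E x y)) => [t|]; first by rewrite !mxE.
  apply: qpolyfunD; first exact: qpolyfun_cst.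
  apply: qpolyfunM; last exact: qpolyfun_cst.
  by split; [exists 'X | exists 0 | exists 0 | exists 0] => t;
     rewrite ?hornerX ?horner0 /= ?mulr1 ?mulr0.
pose f t := qre (cdet beta (N t) i) - qre (cdet beta (N t) j).
have f0 : f 0 = 0.
  apply: polyfun_eq0 => [|t t0].
    by have [[? _ _ _] [? _ _ _]] := (polyN i, polyN j); apply: polyfunB.
  have Nt0 : N t i j != 0 by rewrite Nij scaler_eq0 negb_or t0 oner_eq0.
  by rewrite /f (cancel_M _ (hN t) Nt0) subrr.
rewrite [LHS](conjq_real (cdet_real IH hM ib)).
rewrite [RHS](conjq_real (cdet_real IH hM jb)).
by congr (_ %:A); apply/eqP; rewrite -subr_eq0 -N0; apply/eqP.
Qed.

Lemma herm_expansionP beta M : is_hermitian M -> herm_expansion beta M.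
Proof.
have [m] := ubnP #|beta|; elim: m beta M => // m IHm beta M ltm hM.
have IH gamma (N : 'M[H]_n) : is_hermitian N -> gamma \proper beta -> herm_expansion gamma N.
  by move=> hN /proper_card ltb; apply: IHm => //; apply: leq_trans ltb ltm.
have detE i : i \in beta -> cdet beta M i = T beta M.
  move=> ib; have [|j jb ->] := @ordered_det_min R n beta M; last exact: cdet_indep.
  by apply/set0Pn; exists i.
split=> [|i a ib ab ia|i a ib ab|i q ib qb].
- have [->|b0] := eqVneq beta set0; first by rewrite ordered_det0 conjq1.
  by have [j jb ->] := ordered_det_min M b0; exact: cdet_real.
- exact: expansion_coef_left.
- exact: expansion_coef_conj.
- have [<-|iq] := eqVneq i q; last exact: row_offdiag.
  by rewrite -cdet_coef // detE.
Qed.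

Lemma ordered_det_real beta M : is_hermitian M -> conjq (T beta M) = T beta M.
Proof. by move/(herm_expansionP beta)=> []. Qed.

Lemma cdet_herm beta M i : is_hermitian M -> i \in beta -> cdet beta M i = T beta M.
Proof.
move=> hM ib; rewrite cdet_coef //.
by have [_ _ _ ->] := herm_expansionP beta hM; rewrite ?eqxx.
Qed.

Lemma principal_minor_herm beta M : is_hermitian M ->
  principal_minor beta M = T beta M.
Proof.
move=> hM; rewrite /principal_minor; case: pickP => [j jb|b0].
  exact: cdet_herm.
suff -> : beta = set0 by rewrite ordered_det0.
by apply/setP=> x; rewrite b0 inE.
Qed.

End HermitianExpansion.

(** * Sums of principal minors *)
Section FaddeevLeVerrier.
Variables (R : realFieldType) (n : nat).
Local Notation H := (quat R).
Implicit Types (M : 'M[H]_n) (beta gamma : {set 'I_n}) (i j a b q : 'I_n).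

(** The sum of the adjugates of all blocks of size [m].  It is the matrix of the
    linear map [sum_cdet m M], and plays the role of the coefficients of the
    adjugate of [t I + M], seen as a polynomial in [t]. *)
Definition minor_adj (m : nat) M : 'M[H]_n :=
  \matrix_(i, a) \sum_(beta : {set 'I_n} | [&& #|beta| == m, i \in beta & a \in beta])
    expansion_coef beta M i a.

Lemma sum_cdet_minor_adj m M (c : 'cV[H]_n) i :
  sum_cdet m M c i = (minor_adj m M *m c) i 0.
Proof.
rewrite mxE /sum_cdet; under eq_bigr => beta /andP[_ ib] do rewrite cdet_expand_col //.
under [RHS]eq_bigr do rewrite mxE big_distrl /=.
rewrite (exchange_big_dep (fun beta : {set 'I_n} => (#|beta| == m) && (i \in beta))) /=.
  apply: eq_bigr => beta /andP[-> ->]; apply: eq_bigl => a //.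
by move=> a beta _ /and3P[-> ->].
Qed.

Lemma sum_setU1 m a (F : {set 'I_n} -> H) (P : pred {set 'I_n}) :
  \sum_(beta : {set 'I_n} | [&& #|beta| == m.+1, a \in beta & P (beta :\ a)]) F beta =
  \sum_(gamma : {set 'I_n} | [&& #|gamma| == m, a \notin gamma & P gamma]) F (a |: gamma).
Proof.
rewrite (reindex_onto (fun gamma => a |: gamma) (fun beta => beta :\ a)) /=.
  apply: eq_bigl => gamma; rewrite setU11 cardsU1 /=.
  have [ag|ag] := boolP (a \in gamma) => /=.
    rewrite andbF; apply/negP=> /andP[_ /eqP e].
    by move: ag; rewrite -e !inE eqxx.
  by rewrite setU1K // eqxx andbT eqSS.
by move=> beta /and3P[_ ab _]; rewrite setD1K.
Qed.

Section Hermitian.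
Variable M : 'M[H]_n.
Hypothesis hM : is_hermitian M.

(** Up to sign, a coefficient of the characteristic polynomial of [M]. *)
Definition char_coef m : R := qre (sum_minors m M).

Lemma sum_minors_ordered m : sum_minors m M = \sum_(beta : {set 'I_n} | #|beta| == m) ordered_det beta M.
Proof. by apply: eq_bigr => beta _; exact: principal_minor_herm. Qed.

Lemma sum_minors_real m : sum_minors m M = (char_coef m)%:A.
Proof.
apply: conjq_real; rewrite sum_minors_ordered raddf_sum /=.
by apply: eq_bigr => beta _; exact: ordered_det_real.
Qed.

Lemma minor_adjM m i a : (minor_adj m M *m M) i a =
  \sum_(beta : {set 'I_n} | (#|beta| == m) && (i \in beta))
    \sum_(b in beta) expansion_coef beta M i b * M b a.
Proof.
have -> : (minor_adj m M *m M) i a = sum_cdet m M (col a M) i.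
  by rewrite sum_cdet_minor_adj !mxE; apply: eq_bigr => b _; rewrite [col _ _ _ _]mxE.
rewrite /sum_cdet; apply: eq_bigr => beta /andP[_ ib].
by rewrite cdet_expand_col //; apply: eq_bigr => b _; rewrite mxE.
Qed.

(** The Faddeev-LeVerrier recurrence.  In the product with [M], a block that
    contains [a] contributes its determinant or zero, according to whether
    [a = i]; a block that avoids [a] contributes the opposite of the coefficient
    (i, a) of the block enlarged by [a]. *)
Lemma minor_adjS m : minor_adj m.+1 M = (char_coef m)%:A *: 1%:M - minor_adj m M *m M.
Proof.
apply/matrixP=> i a; apply/eqP; rewrite [X in _ == X]mxE [X in _ + X]mxE -sum_minors_real.
rewrite eq_sym subr_eq [X in _ == X]addrC minor_adjM; apply/eqP; rewrite !mxE.
have expandE beta : i \in beta -> a \in beta ->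
    \sum_(b in beta) expansion_coef beta M i b * M b a =
    if i == a then ordered_det beta M else 0.
  by have [_ _ _] := herm_expansionP beta hM; apply.
have [ia|ia] := eqVneq i a.
  rewrite -{a}ia in expandE *; rewrite mulr1 sum_minors_ordered.
  rewrite (bigID (fun beta => i \in beta)) /=; congr (_ + _).
    by apply: eq_bigr => beta /andP[_ ib]; rewrite expandE // eqxx.
  rewrite [RHS](eq_bigl (fun beta : {set 'I_n} =>
      [&& #|beta| == m.+1, i \in beta & predT (beta :\ i)])) => [|beta]; last first.
    by rewrite andbT andbb.
  rewrite sum_setU1; apply: eq_big => beta; first by rewrite andbT.
  by case/andP=> _ ib; rewrite expansion_coef_diag setU1K.
rewrite mulr0; apply/esym/eqP; rewrite addr_eq0; apply/eqP.
rewrite (bigID (fun beta => a \in beta)) /= big1 ?add0r => [|beta /andP[/andP[_ ib] ab]]; last first.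
  by rewrite expandE // (negPf ia).
rewrite [X in _ = - X](eq_bigl (fun beta : {set 'I_n} =>
    [&& #|beta| == m.+1, a \in beta & i \in beta :\ a])) => [|beta]; last first.
  by rewrite in_setD1 ia /= [_ && (i \in _)]andbC.
rewrite (sum_setU1 m a (fun beta => expansion_coef beta M i a) (fun g : {set _} => i \in g)) -sumrN; apply: eq_big => beta.
  by rewrite -andbA [_ && (i \in _)]andbC.
case/andP=> /andP[_ ib] ab; rewrite expansion_coef_right ?inE ?ib ?orbT // opprK.
by rewrite setU1K.
Qed.

Lemma minor_adj0 : minor_adj 0 M = 0.
Proof.
apply/matrixP=> i a; rewrite !mxE big_pred0 // => beta.
by apply/negP=> /andP[]; rewrite cards_eq0 => /eqP->; rewrite inE.
Qed.

Lemma char_coef0 : char_coef 0 = 1.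
Proof.
rewrite /char_coef sum_minors_ordered (big_pred1 set0) ?ordered_det0 // => beta.
by rewrite cards_eq0.
Qed.

Lemma minor_adj_gt m : (n < m)%N -> minor_adj m M = 0.
Proof.
move=> nm; apply/matrixP=> i a; rewrite !mxE big_pred0 // => beta.
apply/negP=> /andP[/eqP cb]; move: nm.
by rewrite -cb ltnNge (leq_trans (max_card _)) // card_ord.
Qed.

Lemma char_coef_gt m : (n < m)%N -> char_coef m = 0.
Proof.
move=> nm; rewrite /char_coef sum_minors_ordered big_pred0 ?raddf0 // => beta.
apply: contraTF nm => /eqP <-.
by rewrite -leqNgt (leq_trans (max_card _)) // card_ord.
Qed.

Definition re_trace (A : 'M[H]_n) : R := \sum_i qre (A i i).

(** A block of size [m] contributes its determinant once for each of its [m]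
    indices. *)
Lemma minor_adj_trace m : re_trace (minor_adj m M *m M) = m%:R * char_coef m.
Proof.
rewrite /re_trace; under eq_bigr do rewrite minor_adjM raddf_sum /=.
rewrite (exchange_big_dep (fun beta : {set 'I_n} => #|beta| == m)) /=; last first.
  by move=> i beta _ /andP[].
rewrite /char_coef sum_minors_ordered raddf_sum big_distrr /=; apply: eq_bigr => beta /eqP cb.
rewrite cb eqxx /= (eq_bigr (fun=> qre (ordered_det beta M))) => [|i ib].
  by rewrite sumr_const cb mulr_natl.
by have [_ _ _ ->] := herm_expansionP beta hM; rewrite ?eqxx.
Qed.

Lemma minor_adj_comm m : M *m minor_adj m M = minor_adj m M *m M.
Proof.
elim: m => [|m IHm]; first by rewrite minor_adj0 mulmx0 mul0mx.
rewrite minor_adjS mulmxBr mulmxBl mulmxA IHm; congr (_ - _).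
apply/matrixP=> i a; rewrite -scalemxAl mul1mx !mxE (bigD1 a) //= big1 => [|b ba].
  by rewrite !mxE eqxx mulr1 addr0 mulr_algl mulr_algr.
by rewrite !mxE (negPf ba) mulr0 mulr0.
Qed.

End Hermitian.
End FaddeevLeVerrier.

(** * Gram matrices, rank and real trace *)
Section RankAndTrace.
Variable R : realFieldType.
Local Notation H := (quat R).

Lemma adjmxM m n p (A : 'M[H]_(m, n)) (B : 'M[H]_(n, p)) :
  adjmx (A *m B) = adjmx B *m adjmx A.
Proof.
apply/matrixP=> i j; rewrite !mxE raddf_sum /=.
by apply: eq_bigr => k _; rewrite !mxE conjqM.
Qed.

Lemma adjmxK m n (A : 'M[H]_(m, n)) : adjmx (adjmx A) = A.
Proof. by apply/matrixP=> i j; rewrite !mxE conjqK. Qed.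

Lemma adj_mul_eq0 m n (A : 'M[H]_(m, n)) : adjmx A *m A = 0 -> A = 0.
Proof.
move=> AA0; apply/matrixP=> i j; rewrite mxE; apply/eqP; rewrite -normsq_eq0.
have /eqP : \sum_k normsq (A k j) = 0.
  transitivity (qre ((adjmx A *m A) j j)); last by rewrite AA0 mxE.
  rewrite mxE raddf_sum; apply: eq_bigr => k _ /=.
  by rewrite -qre_conj_mul !mxE.
by rewrite psumr_eq0 => [/allP/(_ i)|k _]; [apply; rewrite mem_index_enum | exact: normsq_ge0].
Qed.

Lemma gram_ker m n p (A : 'M[H]_(m, n)) (B : 'M[H]_(n, p)) :
  adjmx A *m A *m B = 0 -> A *m B = 0.
Proof.
by move=> AAB; apply: adj_mul_eq0; rewrite adjmxM -mulmxA (mulmxA (adjmx A)) AAB mulmx0.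
Qed.

Lemma re_traceC n (A B : 'M[H]_n) : re_trace (A *m B) = re_trace (B *m A).
Proof.
rewrite /re_trace; under eq_bigr do rewrite mxE raddf_sum /=.
under [RHS]eq_bigr do rewrite mxE raddf_sum /=.
rewrite exchange_big /=; apply: eq_bigr => i _; apply: eq_bigr => j _.
exact: qreMC.
Qed.

Lemma qrank_ker n m p (A : 'M[H]_(m, n)) (B : 'M[H]_(p, n)) :
  (forall x : 'cV[H]_n, A *m x = 0 <-> B *m x = 0) -> qrank A = qrank B.
Proof.
move=> AB; apply: eq_bigl => S; apply: asbool_equiv_eq.
by split=> HS x xS /AB; apply: HS.
Qed.

(** A free set of columns of maximal size spans all the columns: adding column
    [j] destroys freeness, and the coefficient of [j] in the resulting relation
    is invertible. *)
Lemma qrank_basis m n (A : 'M[H]_(m, n)) :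
  exists S : {set 'I_n}, [/\ right_free_cols A S, #|S| = qrank A &
    forall j, exists2 y : 'cV[H]_n, (forall i, i \notin S -> y i 0 = 0) & A *m y = col j A].
Proof.
pose F := [pred S : {set 'I_n} | `[< right_free_cols A S >]].
have F0 : (0 < #|F|)%N.
  apply/card_gt0P; exists set0; rewrite inE; apply/asboolP=> x x0 _.
  by apply/matrixP=> i j; rewrite ord1 mxE x0 ?inE.
have [S] := eq_bigmax_cond (fun S : {set 'I_n} => #|S|) F0.
rewrite unfold_in /= => /asboolP freeS rankS; exists S; split=> //.
move=> j; have [jS|jS] := boolP (j \in S).
  exists (delta_mx j 0); last by rewrite colE.
  by move=> i iS; rewrite mxE; case: eqP => // e; rewrite -e (negPf iS) in jS.
have [x [xS Ax x0]] : exists x : 'cV[H]_n,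
    [/\ forall i, i \notin j |: S -> x i 0 = 0, A *m x = 0 & x != 0].
  apply: contrapT => nex.
  have : right_free_cols A (j |: S).
    move=> x xS Ax; apply/eqP; apply: contrapT => /negP x0; apply: nex.
    by exists x.
  move=> free_jS; have : (#|j |: S| <= qrank A)%N.
    by apply: leq_bigmax_cond; apply/asboolP.
  by rewrite /qrank rankS cardsU1 jS ltnn.
have xj : x j 0 != 0.
  apply: contra_neq x0 => xj; apply: freeS => // i iS.
  by have [->//|ij] := eqVneq i j; apply: xS; rewrite !inE negb_or ij.
exists (delta_mx j 0 - x *m (x j 0)^-1%:M); last first.
  by rewrite mulmxBr mulmxA Ax mul0mx subr0 colE.
move=> i iS; rewrite !mxE big_ord1 mxE mulr1n eqxx andbT.
have [->|ij] := eqVneq i j; first by rewrite divrr ?subrr.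
have xi : x i 0 = 0 by apply: xS; rewrite !inE negb_or ij.
by rewrite xi mul0r subr0.
Qed.

Lemma mulmx_scale_alg m n p (A : 'M[H]_(m, n)) (B : 'M[H]_(n, p)) (e : R) :
  A *m (e%:A *: B) = e%:A *: (A *m B).
Proof.
apply/matrixP=> i j; rewrite !mxE big_distrr /=; apply: eq_bigr => k _.
by rewrite !mxE !mulr_algl scalerAr.
Qed.

(** The trace of an idempotent is its rank.  If [A = A P] with the rows of [P]
    supported on a basis [S] of the columns of [A], then [A Z] and [P Z A] have
    the same real trace, and the latter matrix is [e] times the identity on [S]
    because the columns of [A] in [S] are free. *)
Lemma re_trace_quasi_idem n (A Z : 'M[H]_n) (e : R) :
  A *m Z *m A = e%:A *: A -> re_trace (A *m Z) = e * (qrank A)%:R.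
Proof.
move=> AZA; have [S [freeS <- spanS]] := qrank_basis A.
have /choice[N NP] : forall j, exists y : 'cV[H]_n,
    (forall i, i \notin S -> y i 0 = 0) /\ A *m y = col j A.
  by move=> j; have [y] := spanS j; exists y.
pose P := \matrix_(i, j) N j i 0 : 'M[H]_n.
have colPE j : col j P = N j by apply/matrixP=> i k; rewrite !mxE (ord1 k).
have AP : A *m P = A.
  apply/matrixP=> i j; have [_ /matrixP/(_ i 0) ANj] := NP j.
  by rewrite -colPE [col j P]colE mulmxA -colE ![col _ _ _ _]mxE in ANj.
pose Y := P *m Z *m A.
have Pout i j : i \notin S -> P i j = 0.
  by move=> iS; rewrite mxE; have [->] := NP j.
have Yout i j : i \notin S -> Y i j = 0.
  move=> iS; rewrite /Y -mulmxA mxE big1 // => k _.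
  by rewrite Pout ?mul0r.
have Yin j : j \in S -> Y j j = e%:A.
  move=> jS; have /matrixP/(_ j 0) : col j (Y - e%:A *: 1%:M) = 0; last first.
    by rewrite !mxE eqxx mulr1 => /eqP; rewrite subr_eq0 => /eqP.
  apply: freeS => [i iS|].
    rewrite [col _ _ _ _]mxE [LHS]mxE Yout // !mxE add0r; apply/eqP; rewrite oppr_eq0.
    by have [ij|_] := eqVneq i j; [rewrite ij jS in iS | rewrite mulr0].
  rewrite colE mulmxA mulmxBr mulmx_scale_alg mulmx1 /Y !(mulmxA A) AP AZA.
  by rewrite subrr mul0mx.
transitivity (re_trace Y); first by rewrite -{1}AP -mulmxA re_traceC.
rewrite /re_trace (bigID (fun j => j \in S)) /= [X in _ + X]big1 ?addr0 => [|j jS]; last first.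
  by rewrite Yout ?raddf0.
by rewrite (eq_bigr (fun=> e)) => [|j jS]; rewrite ?sumr_const ?mulr_natr // Yin // qre_alg.
Qed.

End RankAndTrace.

(** * Cramer's rule for a singular Hermitian matrix *)
Section SingularCramer.
Variables (R : realFieldType) (n : nat).
Local Notation H := (quat R).
Variable M : 'M[H]_n.
Hypothesis hM : is_hermitian M.
Local Notation r := (qrank M).
Local Notation e := (char_coef M).
Local Notation P m := (minor_adj m M).

Lemma alg_inv (a : R) : (a%:A : H)^-1 = (a^-1)%:A.
Proof. exact: (esym (fmorphV (in_alg H) a)). Qed.

(** The Gram matrix of the adjoint of [B M] is [B M M] times the adjoint of [B]. *)
Lemma herm_cancel (B : 'M[H]_n) : B *m M *m M = 0 -> B *m M = 0.
Proof.
move=> BMM; rewrite -[B *m M]adjmxK [adjmx (B *m M)](_ : _ = 0) ?raddf0.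
  by apply/matrixP=> i j; rewrite !mxE raddf0.
apply: adj_mul_eq0; rewrite adjmxK adjmxM hM.
by rewrite mulmxA BMM mul0mx.
Qed.

(** Let [s] be maximal with a nonzero sum of minors of size [s].  Beyond [s] the
    recurrence only multiplies by [- M], and it ends with 0 after size [n];
    powers of a Hermitian matrix cancel, so [P s.+1 *m M = 0].  Therefore
    [M *m P s] acts on the columns of [M] as the scalar [char_coef M s].  Its
    real trace is this scalar times the rank of [M] by [re_trace_quasi_idem],
    and times [s] by [minor_adj_trace]: [s] is the rank. *)
Lemma minor_adj_rank : e r != 0 /\ P r.+1 *m M = 0.
Proof.
have ex0 : exists m, e m != 0 by exists 0%N; rewrite char_coef0 // oner_eq0.
have ub m : e m != 0 -> (m <= n)%N.
  by move=> em; rewrite leqNgt; apply: contra em => nm; rewrite char_coef_gt.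
case: (ex_maxnP ex0 ub) => s es smax.
have e_gt m : (s < m)%N -> e m = 0.
  by move=> sm; apply/eqP; apply: contraTT sm => /smax; rewrite -leqNgt.
have Ps m : P (s.+1 + m)%N *m M = 0 -> P s.+1 *m M = 0.
  elim: m => [|m IHm]; first by rewrite addn0.
  rewrite addnS minor_adjS // e_gt ?leq_addr // !scale0r sub0r mulNmx => /eqP.
  by rewrite oppr_eq0 => /eqP /herm_cancel /IHm.
have PsM : P s.+1 *m M = 0.
  by apply: (Ps (n - s)%N); rewrite minor_adj_gt ?mul0mx // addSn subnKC // ub.
have MPM : M *m P s *m M = (e s)%:A *: M.
  rewrite minor_adj_comm // -[P s *m M](subKr ((e s)%:A *: 1%:M)) -minor_adjS //.
  by rewrite mulmxBl PsM subr0 -scalemxAl mul1mx.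
have := re_trace_quasi_idem MPM; rewrite minor_adj_comm // minor_adj_trace // mulrC.
by move=> /(mulfI es) /eqP; rewrite eqr_nat => /eqP <-.
Qed.

(** On the range of [M] the last term of the recurrence vanishes. *)
Lemma cramer_range (z : 'cV[H]_n) i :
  sum_cdet r M (M *m (M *m z)) i / sum_minors r M = (M *m z) i 0.
Proof.
have [er PM] := minor_adj_rank.
rewrite sum_cdet_minor_adj mulmxA -[P r *m M](subKr ((e r)%:A *: 1%:M)) -minor_adjS //.
rewrite mulmxBl [P _ *m _]mulmxA PM mul0mx subr0 -scalemxAl mul1mx mxE sum_minors_real //.
by rewrite alg_inv mulr_algl mulr_algr scalerA mulVf // scale1r.
Qed.

(** Without any hypothesis on [x], the determinantal formula still returns a
    solution of the system with right-hand side [M x]. *)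
Lemma cramer_solves (x : 'cV[H]_n) :
  M *m (\col_i (sum_cdet r M (M *m x) i / sum_minors r M)) = M *m x.
Proof.
have [er PM] := minor_adj_rank.
have -> : \col_i (sum_cdet r M (M *m x) i / sum_minors r M) =
    ((e r)^-1)%:A *: (P r *m (M *m x)).
  apply/matrixP=> i j; rewrite [j]ord1 [LHS]mxE [RHS]mxE sum_cdet_minor_adj.
  by rewrite sum_minors_real // alg_inv mulr_algl mulr_algr.
rewrite mulmx_scale_alg mulmxA minor_adj_comm // -[P r *m M](subKr ((e r)%:A *: 1%:M)).
rewrite -minor_adjS // mulmxBl [P _ *m (_ *m x)]mulmxA PM mul0mx subr0 -scalemxAl mul1mx.
by apply/matrixP=> i j; rewrite !mxE !mulr_algl scalerA mulVf // scale1r.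
Qed.

End SingularCramer.

(** * The Drazin inverse and the particular solution *)
Section Drazin.
Variables (R : realFieldType) (n k : nat).
Local Notation H := (quat R).
Variables A D : 'M[H]_n.
Hypothesis drazinA : is_drazin A k D.

Lemma mxexprD (B : 'M[H]_n) j l : B ^+ (j + l) = B ^+ j *m B ^+ l.
Proof. exact: exprD. Qed.

(** [A D] is an idempotent that fixes [D]. *)
Lemma drazin_exprM j : A ^+ j *m D ^+ j.+1 = D.
Proof.
have [DAD AD _] := drazinA; change (A ^+ j * D ^+ j.+1 = D).
rewrite exprSr mulrA -exprMn_comm //; elim: j => [|j IHj]; first by rewrite expr0 mul1r.
rewrite exprSr -mulrA (_ : A * D * D = D) //.
by change (A *m D *m D = D); rewrite AD.
Qed.

Lemma drazin_exprM_col j (c : 'cV[H]_n) : A ^+ j *m (D ^+ j.+1 *m c) = D *m c.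
Proof. by rewrite mulmxA drazin_exprM. Qed.

Lemma drazin_absorb j : A ^+ (k + j) *m D ^+ j = A ^+ k.
Proof.
have [_ AD AkD] := drazinA; change (A ^+ (k + j) * D ^+ j = A ^+ k).
rewrite exprD -mulrA -exprMn_comm //; elim: j => [|j IHj]; first by rewrite expr0 mulr1.
by rewrite exprSr mulrA IHj mulrA -exprSr.
Qed.

Lemma drazin_comm j l : A ^+ j *m D ^+ l = D ^+ l *m A ^+ j.
Proof. by have [_ AD _] := drazinA; apply: commrX; apply/commr_sym/commrX/commr_sym. Qed.

Lemma hermX j : is_hermitian A -> is_hermitian (A ^+ j).
Proof.
move=> hA; elim: j => [|j IHj]; last first.
  by rewrite /is_hermitian -[in LHS]addn1 mxexprD adjmxM IHj hA -(mxexprD A 1).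
by apply/matrixP=> x y; rewrite !mxE eq_sym; case: eqP; rewrite /= ?conjq1 ?raddf0.
Qed.

Section Solution.
Variable b : 'cV[H]_n.

(** [D A^m b] lies in the range of [A^(k+1)], and its image under this matrix is
    [A^(k+m) b]. *)
Lemma C_herm_drazin m i : is_hermitian A ->
  C_herm A b k (qrank (A ^+ k.+1)) m i = (D *m (A ^+ m *m b)) i 0.
Proof.
move=> hA; pose z := D ^+ k.+2 *m (A ^+ m *m b).
have Mz : A ^+ k.+1 *m z = D *m (A ^+ m *m b) by exact: drazin_exprM_col.
rewrite /C_herm (_ : bhat A b (k + m) = A ^+ k.+1 *m (A ^+ k.+1 *m z)).
  by rewrite cramer_range ?Mz //; apply: hermX.
have [_ _ AkD] := drazinA.
by rewrite Mz [RHS]mulmxA AkD /bhat mxexprD -mulmxA.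
Qed.

(** With [B = A^(2k+1)], the column [x = D^(k+1) A^m b] solves [B x = A^(k+m) b]
    and [A^k x = D A^m b].  The determinantal formula for the Gram matrix of [B]
    gives a possibly different solution [z] of the normal equations; but the
    kernels of this Gram matrix, of [B] and of [A^k] coincide, so
    [A^k z = A^k x]. *)
Lemma C_gen_drazin m i :
  C_gen A b k (qrank (A ^+ k)) m i = (D *m (A ^+ m *m b)) i 0.
Proof.
rewrite /C_gen; set B := A ^+ (2 * k).+1; set G := adjmx B *m B.
have hG : is_hermitian G by rewrite /is_hermitian /G adjmxM adjmxK.
have Bk : B = A ^+ (k + k.+1) by rewrite /B addnS mul2n addnn.
have BD : B *m D ^+ k.+1 = A ^+ k by rewrite Bk drazin_absorb.
have kerB (x : 'cV[H]_n) : B *m x = 0 -> A ^+ k *m x = 0.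
  by move=> Bx; rewrite -BD Bk drazin_comm -Bk -mulmxA Bx mulmx0.
have -> : qrank (A ^+ k) = qrank G.
  apply: qrank_ker => x; split=> [Akx|/gram_ker/kerB//].
  by rewrite /G Bk addnC mxexprD -[_ *m x]mulmxA -[_ *m _ *m x]mulmxA Akx !mulmx0.
pose x := D ^+ k.+1 *m (A ^+ m *m b).
have -> : dhat A b k m = G *m x.
  rewrite /dhat -/B -[RHS]mulmxA; congr (_ *m _).
  by rewrite [RHS]mulmxA BD mxexprD mulmxA.
have /eqP := cramer_solves hG x; set z := \col_i _ => Gz.
have Akz : A ^+ k *m z = A ^+ k *m x.
  apply/eqP; rewrite -subr_eq0 -mulmxBr; apply/eqP/kerB/gram_ker.
  by apply/eqP; rewrite -/G mulmxBr subr_eq0.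
transitivity ((A ^+ k *m z) i 0).
  by rewrite mxE big_distrl; apply: eq_bigr => s _; rewrite /= mxE mulrA.
by rewrite Akz drazin_exprM_col.
Qed.

Lemma particular_solutionE C t i :
  (forall m, C m = (D *m (A ^+ m *m b)) i 0) ->
  particular_solution A D b k t i 0 = - C 0%N +
     \sum_(1 <= m < k.+1) (t ^+ m / m`!%:R) *: (bhat A b m.-1 i 0 - C m).
Proof.
move=> CE; rewrite [LHS]mxE summxE CE expr0 mul1mx [X in X + _]mxE; congr (_ + _).
apply: eq_bigr => m _; rewrite CE -mulmxA [LHS]mxE mulr_algl.
by rewrite [X in _ *: X]mxE [X in _ + X]mxE.
Qed.

Let w m := A ^+ m *m b - D *m (A ^+ m.+1 *m b).

(** Multiplication by [A] shifts the coefficients [w], and the exponential series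
    stops because [w k = 0], by the equation [A^(k+1) D = A^k]. *)
Lemma particular_solution_rhs t : A *m particular_solution A D b k t + b =
  \sum_(0 <= m < k) ((t ^+ m / m`!%:R)%:A : H) *: w m.
Proof.
have [_ AD AkD] := drazinA.
have AX j (c : 'cV[H]_n) : A *m (A ^+ j *m c) = A ^+ j.+1 *m c.
  by rewrite mulmxA -(mxexprD A 1).
have Aw m : A *m w m = w m.+1.
  by rewrite /w mulmxBr AX [A *m (D *m _)]mulmxA AD -[D *m A *m _]mulmxA AX.
have wk : w k = 0.
  by rewrite /w -[D]expr1 mulmxA -drazin_comm expr1 AkD subrr.
have <- : \sum_(0 <= m < k.+1) ((t ^+ m / m`!%:R)%:A : H) *: w m =
    \sum_(0 <= m < k) ((t ^+ m / m`!%:R)%:A : H) *: w m.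
  by rewrite big_nat_recr //= wk scaler0 addr0.
rewrite big_nat_recl // mulmxDr mulmxN mulmx_sumr.
rewrite big_add1 addrAC /=; congr (_ + _).
  rewrite /w !expr0 fact0 divr1 !scale1r mul1mx expr1 [RHS]addrC [D *m (A *m b)]mulmxA.
  by rewrite -AD -mulmxA.
by apply: eq_bigr => m _; rewrite mulmx_scale_alg -mulmxA Aw.
Qed.

End Solution.
End Drazin.

(** * The differential system *)
Section Derivative.
Variable R : realType.

Lemma is_derive_exp_sum (k : nat) (v0 : R) (v : nat -> R) (t : R) :
  is_derive t 1 (fun u : R => v0 + \sum_(0 <= m < k) u ^+ m.+1 / (m.+1)`!%:R * v m)
    (\sum_(0 <= m < k) t ^+ m / m`!%:R * v m).
Proof.
pose p : {poly R} := v0%:P + \sum_(0 <= m < k) (v m / (m.+1)`!%:R) *: 'X^(m.+1).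
have -> : (fun u : R => v0 + \sum_(0 <= m < k) u ^+ m.+1 / (m.+1)`!%:R * v m) = horner p.
  apply/funext=> u; rewrite hornerD hornerC horner_sum; congr (_ + _).
  by apply: eq_bigr => m _; rewrite hornerZ hornerXn [u ^+ _ / _]mulrC [LHS]mulrC mulrA.
have -> : \sum_(0 <= m < k) t ^+ m / m`!%:R * v m = p^`().[t].
  rewrite derivD derivC add0r raddf_sum horner_sum; apply: eq_bigr => m _ /=.
  rewrite derivZ derivXn hornerZ hornerMn hornerXn /= factS natrM.
  have m1 : m.+1%:R != 0 :> R by rewrite pnatr_eq0.
  have m2 : m`!%:R != 0 :> R by rewrite pnatr_eq0 -lt0n fact_gt0.
  rewrite -(mulr_natr (t ^+ m)).
  by move: (m.+1%:R) (m`!%:R) m1 m2 => x y x0 y0; field; rewrite x0 y0.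
exact: is_derive_poly.
Qed.

Lemma is_qderive_exp_sum (k : nat) (v0 : quat R) (v : nat -> quat R) (f : R -> quat R) t :
  (forall u, f u = v0 + \sum_(0 <= m < k) (u ^+ m.+1 / (m.+1)`!%:R) *: v m) ->
  is_qderive f t (\sum_(0 <= m < k) (t ^+ m / m`!%:R) *: v m).
Proof.
move=> fE.
have component (phi : {additive quat R -> R}) : (forall a x, phi (a *: x) = a * phi x) ->
    is_derive t 1 (fun u => phi (f u)) (phi (\sum_(0 <= m < k) (t ^+ m / m`!%:R) *: v m)).
  move=> phiZ; rewrite raddf_sum; under eq_bigr do rewrite phiZ.
  rewrite (_ : (fun u => _) = (fun u : R => phi v0 +
      \sum_(0 <= m < k) u ^+ m.+1 / (m.+1)`!%:R * phi (v m))); first exact: is_derive_exp_sum.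
  apply/funext=> u; rewrite fE raddfD raddf_sum; congr (_ + _).
  by apply: eq_bigr => m _; rewrite phiZ.
by split; apply: component.
Qed.

Lemma particular_solution_solves n k (A D : 'M[quat R]_n) (b : 'cV[quat R]_n) X :
  is_drazin A k D -> (forall t, X t = particular_solution A D b k t) ->
  solves_system A b X.
Proof.
move=> drazinA XE t i; rewrite XE particular_solution_rhs // summxE.
under eq_bigr do rewrite mxE mulr_algl.
apply: (@is_qderive_exp_sum _ (- (D *m b) i 0)) => u.
rewrite XE mxE [X in X + _]mxE summxE big_add1; congr (_ + _).
by apply: eq_bigr => m _; rewrite mxE mulr_algl -mulmxA.
Qed.

End Derivative.

Theorem theorem3p16 (R : realType) (n k r : nat) (A AD : 'M[quat R]_n)
    (b : 'cV[quat R]_n) (X : R -> 'cV[quat R]_n)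
    (indA : is_index A k)
    (rankSk : qrank (A ^+ k.+1) = r) (rankk : qrank (A ^+ k) = r)
    (le_rn : (r <= n)%N)
    (drazinA : is_drazin A k AD)
    (defX : forall t, X t = particular_solution A AD b k t) :
  [/\ solves_system A b X,
      is_hermitian A ->
        forall (i : 'I_n) (t : R),
          X t i 0 = - C_herm A b k r 0 i +
            \sum_(1 <= m < k.+1)
              (t ^+ m / m`!%:R) *:
                (bhat A b m.-1 i 0 - C_herm A b k r m i) &
      forall (i : 'I_n) (t : R),
        X t i 0 = - C_gen A b k r 0 i +
          \sum_(1 <= m < k.+1)
            (t ^+ m / m`!%:R) *:
              (bhat A b m.-1 i 0 - C_gen A b k r m i)].
Proof.
split=> [|hA i t|i t]; first exact: particular_solution_solves drazinA defX.
- rewrite defX; apply: particular_solutionE => m.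
  by rewrite -rankSk; apply: C_herm_drazin.
- rewrite defX; apply: particular_solutionE => m.
  by rewrite -rankk; apply: C_gen_drazin.
Qed.
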